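(* For every stream $s$: $\mu\mathcal{W}\,s$ if and only if the set $\mathcal{R}_s$ of red positions of $s$ is Noetherian, i.e. $\mathit{Noet}\,\mathcal{R}_s$.
   Context: The statement is to be proved constructively (intuitionistic type theory with inductive and coinductive definitions; no excluded middle, no Markov's principle). A color is one of $R$ (red), $B$ (blue). A stream is an element of the coinductive type whose only constructor forms $c\,s$ from a color $c$ and a stream $s$; streams are considered up to bisimilarity (equivalently, functions $\mathbb{N}\to\{R,B\}$ up to pointwise equality). $s@n$ denotes the color of $s$ at position $n$ (positions start at $0$), and $\mathcal{R}_s=\{n\in\mathbb{N}\mid s@n=R\}$. For a stream predicate $X$, the weak until predicate $\mathcal{W}_X$ is defined coinductively by the rules: $\mathcal{W}_X\,s$ implies $\mathcal{W}_X\,(B\,s)$; $X\,s$ implies $\mathcal{W}_X\,(R\,s)$. The operator $X\mapsto\mathcal{W}_X$ is monotone, and $\mu\mathcal{W}$ (''almost always blue'') is its least fixed point, i.e. the predicate defined inductively by the rule: $\mathcal{W}_{\mu\mathcal{W}}\,s$ implies $\mu\mathcal{W}\,s$ (equivalently, Mendler-style: if $X$ is a stream predicate with $\forall s'.\,X\,s'\Rightarrow\mu\mathcal{W}\,s'$ and $\mathcal{W}_X\,s$, then $\mu\mathcal{W}\,s$). For a set $A$ (here: decidable sets of natural numbers), $\mathit{Noet}\,A$ is defined inductively by the single rule: if $\mathit{Noet}\,(A\setminus\{x\})$ for all $x\in A$, then $\mathit{Noet}\,A$. *)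

(* Defs.v *)
From Stdlib Require Export Streams.

Inductive color : Set := R | B.

Definition stream := Stream color.

Definition red_positions (s : stream) : nat -> Prop :=
  fun n => Str_nth n s = R.

CoInductive W (X : stream -> Prop) : stream -> Prop :=
| W_blue : forall s, W X s -> W X (Cons B s)
| W_red : forall s, X s -> W X (Cons R s).

(* Mendler-style least fixed point of [W].  The direct rule
   [W muW s -> muW s] nests an inductive predicate inside a coinductive one,
   where Rocq's guard condition rejects the proof of the induction principle.
   The lemmas below show that [muW] satisfies that rule and is the least
   predicate that does. *)
Inductive muW : stream -> Prop :=
| muW_intro : forall (X : stream -> Prop) (s : stream),
    (forall s', X s' -> muW s') -> W X s -> muW s.

Lemma W_monotone (X Y : stream -> Prop) :
  (forall s, X s -> Y s) -> forall s, W X s -> W Y s.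
Proof.
  intros HXY. cofix IH. intros s [s' H | s' H].
  - apply W_blue. apply IH. exact H.
  - apply W_red. apply HXY. exact H.
Qed.

Lemma muW_fold (s : stream) : W muW s -> muW s.
Proof. exact (muW_intro muW s (fun _ h => h)). Qed.

Lemma muW_least (X : stream -> Prop) :
  (forall s, W X s -> X s) -> forall s, muW s -> X s.
Proof.
  intros HX s H. induction H as [Y s _ IH HW].
  apply HX. exact (W_monotone Y X IH s HW).
Qed.

(* Stated for arbitrary predicates on [nat]; since equality on [nat] is
   decidable, only decidable sets are reached from a decidable [A]. *)
Inductive Noet (A : nat -> Prop) : Prop :=
| Noet_intro :
    (forall x, A x -> Noet (fun y => A y /\ y <> x)) -> Noet A.

(* Main.v *)
From Stdlib Require Import Arith Lia.
Require Import Defs.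

(** From left to right, the coinductive proof of [W X s] is only inspected once
    a red position of [s] is given: it then takes finitely many steps to reach
    a red position whose tail satisfies [X].  From right to left, the first red
    position of [s], if any, is removed from the Noetherian set when passing to
    the tail behind it. *)

(** Removing [x] from [C] is matched by removing [f x] from [A]: injectivity on [C] keeps the other
    images away from [f x]. *)
Lemma Noet_preimage (A : nat -> Prop) (f : nat -> nat) :
  Noet A -> forall C : nat -> Prop,
  (forall y, C y -> A (f y)) ->
  (forall y z, C y -> C z -> f y = f z -> y = z) -> Noet C.
Proof.
  induction 1 as [A _ IH]; intros C HCA Hinj.
  constructor; intros x Hx.
  apply (IH (f x) (HCA x Hx)).
  - intros y [Hy Hyx]; split; [auto |].
    intros E; apply Hyx; auto.
  - intros y z [Hy _] [Hz _]; auto.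
Qed.

Lemma Noet_subset (A C : nat -> Prop) :
  Noet A -> (forall y, C y -> A y) -> Noet C.
Proof.
  intros HA HCA; apply (Noet_preimage A (fun y => y) HA); auto.
Qed.

Lemma Noet_add (A : nat -> Prop) (p : nat) :
  Noet A -> Noet (fun y => y = p \/ A y).
Proof.
  induction 1 as [A HA IH].
  constructor; intros x Hx.
  destruct (Nat.eq_dec x p) as [-> | Hxp].
  - apply (Noet_subset A); [constructor; exact HA |].
    intros y [[Hy | Hy] Hyp]; [contradiction | exact Hy].
  - destruct Hx as [Hx | Hx]; [contradiction |].
    apply (Noet_subset _ _ (IH x Hx)).
    intros y [[Hy | Hy] Hyx]; auto.
Qed.

Lemma Noet_red_cons (c : color) (s : stream) :
  Noet (red_positions s) -> Noet (red_positions (Cons c s)).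
Proof.
  intros Hs.
  apply (Noet_subset (fun y => y = 0 \/ (y <> 0 /\ red_positions s (pred y)))).
  - apply Noet_add, (Noet_preimage _ pred Hs).
    + intros y [_ Hy]; exact Hy.
    + intros y z [Hy _] [Hz _]; lia.
  - intros [| y] Hy; [left; reflexivity |].
    right; split; [discriminate | exact Hy].
Qed.

(** The red position [x] bounds how many blue heads are unfolded from [W X s]. *)
Lemma W_Noet_red (X : stream -> Prop) :
  (forall s, X s -> Noet (red_positions s)) ->
  forall x s, W X s -> red_positions s x -> Noet (red_positions s).
Proof.
  intros HX; induction x as [| x IH]; intros s [s' Hs | s' Hs] Hx;
    try (apply Noet_red_cons, HX, Hs).
  - discriminate Hx.
  - apply Noet_red_cons, IH; assumption.
Qed.

Lemma muW_Noet_red (s : stream) : muW s -> Noet (red_positions s).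
Proof.
  induction 1 as [X s _ IH HW].
  (* The element [x] to be removed supplies the red position; its removal is then forgotten. *)
  constructor; intros x Hx.
  apply (Noet_subset (red_positions s)).
  - exact (W_Noet_red X IH x s HW Hx).
  - intros y [Hy _]; exact Hy.
Qed.

(* Keeping [A] fixed and tracking the offset [n] avoids renumbering the
   positions of the tails of [s]. *)
Lemma Noet_muW (A : nat -> Prop) :
  Noet A -> forall n s, (forall y, red_positions s y -> A (n + y)) -> muW s.
Proof.
  induction 1 as [A _ IH]; intros n s Hs.
  apply muW_fold; revert n s Hs; cofix CH; intros n [[|] s] Hs.
  (* The red head sits at [n] in [A]; the tail starts at [S n], so it survives the removal of
     [n]. *)
  - apply W_red, (IH n) with (n := S n).
    + rewrite <- (Nat.add_0_r n); apply (Hs 0); reflexivity.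
    + intros y Hy; split; [| lia].
      rewrite Nat.add_succ_comm; apply (Hs (S y)); exact Hy.
  - apply W_blue, (CH (S n)).
    intros y Hy; rewrite Nat.add_succ_comm; apply (Hs (S y)); exact Hy.
Qed.

Theorem corollary5p1 : forall s : stream, muW s <-> Noet (red_positions s).
Proof.
  intros s; split; [apply muW_Noet_red |].
  intros Hs; exact (Noet_muW _ Hs 0 s (fun _ h => h)).
Qed.
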